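(* Let $R$ be a ring and let $\mathfrak{X}$ be a class of left $R$-modules that contains all projective left $R$-modules. Then $$l.\mathrm{FGPD}(R)=l.\mathfrak{X}\text{-}\mathrm{FGPD}(R)=l.\mathrm{FPD}(R).$$
   Context: $R$ is a non-trivial associative ring with identity; all modules are unital left $R$-modules. A module $G$ is called $\mathfrak{X}$-Gorenstein projective if there is an exact sequence $\cdots\to P_1\to P_0\to P^0\to P^1\to\cdots$ of projective modules which remains exact after applying $\mathrm{Hom}_R(-,X)$ for every $X\in\mathfrak{X}$, and such that $G=\mathrm{Ker}(P_0\to P^0)$ (up to isomorphism). When $\mathfrak{X}$ is the class of projective modules, these are the Gorenstein projective modules. For a module $M$, $\mathfrak{X}\text{-}\mathrm{Gpd}(M)$ is the infimum of all integers $n\ge 0$ for which there is an exact sequence $0\to G_n\to\cdots\to G_1\to G_0\to M\to 0$ with all $G_i$ $\mathfrak{X}$-Gorenstein projective, and $\infty$ if there is no such $n$; $\mathrm{Gpd}(M)$ is defined in the same way using Gorenstein projective modules, and $\mathrm{pd}(M)$ is the projective dimension. The left finitistic dimensions are $l.\mathfrak{X}\text{-}\mathrm{FGPD}(R)=\sup\{\mathfrak{X}\text{-}\mathrm{Gpd}(M)\mid M \text{ a left } R\text{-module with } \mathfrak{X}\text{-}\mathrm{Gpd}(M)<\infty\}$, $l.\mathrm{FGPD}(R)=\sup\{\mathrm{Gpd}(M)\mid M \text{ a left } R\text{-module with } \mathrm{Gpd}(M)<\infty\}$, $l.\mathrm{FPD}(R)=\sup\{\mathrm{pd}(M)\mid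 M \text{ a left } R\text{-module with } \mathrm{pd}(M)<\infty\}$. *)

(* Defs.v *)
From HB Require Import structures.
From mathcomp Require Import all_boot all_order all_algebra.
From mathcomp Require Import boolp classical_sets reals ereal Rstruct.

Set Implicit Arguments.
Unset Strict Implicit.
Unset Printing Implicit Defensive.

Import Order.TTheory GRing.Theory Num.Theory.
Local Open Scope classical_set_scope.
Local Open Scope ring_scope.

Section Modules.
Variable R : nzRingType.

Definition module_class := lmodType R -> Prop.

Definition projective (P : lmodType R) : Prop :=
  forall (A B : lmodType R) (g : {linear A -> B}) (f : {linear P -> B}),
    (forall b, exists a, g a = b) ->
    exists h : {linear P -> A}, g \o h =1 f.

Section Exactness.
Variables A B C : lmodType R.
Implicit Types (f : {linear A -> B}) (g : {linear B -> C}).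

Definition exact_at f g : Prop :=
  forall b, g b = 0 <-> exists a, f a = b.

(* Exactness of Hom(C, X) -> Hom(B, X) -> Hom(A, X) at Hom(B, X). *)
Definition hom_exact_at f g (X : lmodType R) : Prop :=
  forall h : {linear B -> X},
    (forall a, h (f a) = 0) <-> exists k : {linear C -> X}, k \o g =1 h.

End Exactness.

(* ... -> left_obj 1 -> left_obj 0 -> right_obj 0 -> right_obj 1 -> ... *)
Record sequence := Sequence {
  left_obj : nat -> lmodType R;
  right_obj : nat -> lmodType R;
  left_map : forall n, {linear left_obj n.+1 -> left_obj n};
  mid_map : {linear left_obj 0%N -> right_obj 0%N};
  right_map : forall n, {linear right_obj n -> right_obj n.+1} }.

Definition at_all_terms (S : sequence)
    (E : forall A B C : lmodType R,
       {linear A -> B} -> {linear B -> C} -> Prop) : Prop :=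
  [/\ forall n, E _ _ _ (left_map S n.+1) (left_map S n),
      E _ _ _ (left_map S 0) (mid_map S),
      E _ _ _ (mid_map S) (right_map S 0)
    & forall n, E _ _ _ (right_map S n) (right_map S n.+1)].

Definition projective_terms (S : sequence) : Prop :=
  forall n, projective (left_obj S n) /\ projective (right_obj S n).

Definition exact (S : sequence) : Prop := at_all_terms S exact_at.

Definition hom_exact (S : sequence) (X : lmodType R) : Prop :=
  at_all_terms S (fun A B C f g => @hom_exact_at A B C f g X).

(* G is isomorphic to the kernel of f, embedded in A by i. *)
Definition is_kernel (G A B : lmodType R) (f : {linear A -> B}) : Prop :=
  exists i : {linear G -> A},
    injective i /\ forall a, f a = 0 <-> exists x, i x = a.

Definition X_Gorenstein_projective (X : module_class) (G : lmodType R) : Prop :=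
  exists S : sequence,
    [/\ projective_terms S, exact S,
        forall M, X M -> hom_exact S M
      & is_kernel G (mid_map S)].

Definition Gorenstein_projective : module_class :=
  X_Gorenstein_projective projective.

(* 0 -> G_n -> ... -> G_0 -> M -> 0, continued to the left by zero modules;
   exactness at G_n then says that the map out of G_n is injective. *)
Definition has_resolution (C : module_class) (M : lmodType R) (n : nat) : Prop :=
  exists (G : nat -> lmodType R) (d : forall i, {linear G i.+1 -> G i})
         (aug : {linear G 0%N -> M}),
    [/\ forall i, (i <= n)%N -> C (G i),
        forall i, (n < i)%N -> forall x : G i, x = 0,
        forall i, exact_at (d i.+1) (d i),
        exact_at (d 0%N) aug
      & forall m, exists x, aug x = m].

(* The library's infimum of the empty set is +oo. *)
Definition resolution_dim (C : module_class) (M : lmodType R)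
    : \bar Rdefinitions.R :=
  ereal_inf [set n%:R%:E | n in [set n | has_resolution C M n]].

Definition finitistic_dim (dim : lmodType R -> \bar Rdefinitions.R)
    : \bar Rdefinitions.R :=
  ereal_sup [set e | exists2 M : lmodType R, (dim M < +oo)%E & e = dim M].

Definition pd := resolution_dim projective.
Definition X_Gpd (X : module_class) :=
  resolution_dim (X_Gorenstein_projective X).
Definition Gpd := resolution_dim Gorenstein_projective.

End Modules.

Definition FPD (R : nzRingType) := finitistic_dim (@pd R).
Definition X_FGPD (R : nzRingType) (X : module_class R) :=
  finitistic_dim (X_Gpd X).
Definition FGPD (R : nzRingType) := finitistic_dim (@Gpd R).

(* Main.v *)
Require Import Defs.
From HB Require Import structures.
From mathcomp Require Import all_boot all_order all_algebra.
From mathcomp Require Import boolp ereal Rstruct.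
From mathcomp Require Import ring_quotient.

(** Write GP for the X-Gorenstein projective modules.  The whole theorem
    follows from FPD = X-FGPD for an arbitrary class X containing the
    projectives ([X_FGPD_FPD]), because FGPD is the case where X is the class
    of projectives.  Both inequalities compare single modules.

    X-FGPD <= FPD.  A module M with a GP resolution of length n embeds in a
    module L of projective dimension at most n, with a GP cokernel
    ([resolvable_envelope]): this is built by induction on n, by pushing out
    the envelope of the first syzygy and embedding the result, an extension of
    GP modules, in a projective module.  Conversely any GP resolution of L
    yields one of M of the same length ([resolvable_kernel]).  As projective
    resolutions are GP resolutions, X-Gpd M <= pd L, and pd L is finite.

    FPD <= X-FGPD.  If pd L is finite then every GP resolution of L of length
    m can be replaced by a projective one of length m ([PD_of_resolvable]), so
    pd L <= X-Gpd L.  By induction on m, through the pullback of a projective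
    and a GP presentation of L, this reduces to m = 0: a GP module L of finite
    projective dimension is projective, because Ext^1(G, L) = 0 for each GP
    module G ([PD_ext_trivial]), so that the embedding of L in a projective
    module with GP cokernel splits.

    What is needed about GP is thus its closure under extensions and under
    kernels of epimorphisms.  Working with unbounded complexes is avoided by a
    coinductive description: GP is the largest class whose members G satisfy
    Ext^1(G, Y) = 0 for all Y in X and have a syzygy and a cosyzygy in the
    class ([GP_coresolving], [coresolving_GP]).  Closure under extensions is
    then a one-step horseshoe argument on each side.  No derived functor is
    used: Ext^1(G, Y) = 0 is expressed by saying that maps to Y extend along
    every monomorphism with cokernel G. *)

Set Implicit Arguments.
Unset Strict Implicit.
Unset Printing Implicit Defensive.

Import Order.TTheory GRing.Theory Num.Theory.
Local Open Scope ring_scope.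
Local Open Scope quotient_scope.
Import Quotient.

(** * Submodules, quotients and linear maps *)

Section QuotientModule.
Variables (R : nzRingType) (V : lmodType R) (I : zmodClosed V).
Hypothesis scaleI : forall a x, x \in I -> a *: x \in I.

Definition quot_scale (a : R) (q : (quot I)) : (quot I) :=
  \pi_(quot I) (a *: repr q).

Lemma pi_scale a x : quot_scale a (\pi_(quot I) x) = \pi_(quot I) (a *: x).
Proof.
apply/eqP; rewrite /quot_scale -Quotient.idealrBE -scalerBr scaleI //.
by rewrite Quotient.idealrBE reprK.
Qed.

Lemma quot_scaleA a b q : quot_scale a (quot_scale b q) = quot_scale (a * b) q.
Proof. by rewrite (pi_scale a (b *: repr q)) scalerA. Qed.

Lemma quot_scale1 : left_id 1 quot_scale.
Proof. by move=> q; rewrite /quot_scale scale1r reprK. Qed.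

Lemma quot_scaleDr : right_distributive quot_scale +%R.
Proof.
move=> a p q; have -> : p + q = \pi_(quot I) (repr p + repr q).
  by rewrite raddfD /= !reprK.
by rewrite pi_scale scalerDr raddfD.
Qed.

Lemma quot_scaleDl q : {morph quot_scale^~ q : a b / a + b}.
Proof. by move=> a b; rewrite /quot_scale scalerDl raddfD. Qed.

Definition quot_lmod : lmodType R := HB.pack (quot I)
  (GRing.Zmodule_isLmodule.Build R (quot I)
    quot_scaleA quot_scale1 quot_scaleDr quot_scaleDl).

Lemma pi_is_linear : linear (\pi_(quot I) : V -> quot_lmod).
Proof.
by move=> a x y; rewrite raddfD; congr (_ + _); exact: (esym (pi_scale a x)).
Qed.
End QuotientModule.

Section Modules.
Variable R : nzRingType.
Implicit Types A B C D E F G H K L M N P Q X Z : lmodType R.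

Lemma linear_map_of A B (f : A -> B) : linear f -> exists h : {linear A -> B}, h =1 f.
Proof.
move=> lin_f.
pose fL : {linear A -> B} := HB.pack f (GRing.isLinear.Build _ _ _ _ f lin_f).
by exists fL.
Qed.

(** All maps below that are not composites are obtained by diagram chasing;
    this turns such a chase, which defines a linear relation, into a linear
    map. *)
Lemma linear_map_of_graph A B (r : A -> B -> Prop) :
  (forall x, exists y, r x y) -> (forall y, r 0 y -> y = 0) ->
  (forall a x x' y y', r x y -> r x' y' -> r (a *: x + x') (a *: y + y')) ->
  exists h : {linear A -> B}, forall x, r x (h x).
Proof.
move=> /choice[f rf] r0 rD.
have lin_f : linear f.
  move=> a x x'; apply/esym/subr0_eq; apply: r0.
  have := rD (-1) _ _ _ _ (rf (a *: x + x')) (rD a _ _ _ _ (rf x) (rf x')).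
  by rewrite !scaleN1r addNr [- f _ + _]addrC.
by have [h hE] := linear_map_of lin_f; exists h => x; rewrite hE.
Qed.

Section Sub.
Variables (M : lmodType R) (S : M -> Prop).
Hypotheses (S0 : S 0) (SP : forall a x y, S x -> S y -> S (a *: x + y)).

Let Sb : pred M := fun x => `[< S x >].

Lemma exists_submodule : exists (N : lmodType R) (i : {linear N -> M}),
  injective i /\ forall m, S m <-> exists x, i x = m.
Proof.
have clS : subsemimod_closed Sb.
  split; first split.
  - exact/asboolP.
  - move=> x y /asboolP Sx /asboolP Sy; apply/asboolP.
    by rewrite -[x]scale1r; exact: SP.
  - move=> a x /asboolP Sx; apply/asboolP; rewrite -[_ *: _]addr0; exact: SP.
pose N : lmodType R := HB.pack {x | Sb x}
  (GRing.SubChoice_isSubLmodule.Build _ _ _ {x | Sb x} clS).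
have [i iE] : exists i : {linear N -> M}, i =1 (val : {x | Sb x} -> M).
  by apply: linear_map_of => a x y.
exists N, i; split=> [x y|m]; first by rewrite !iE; exact: val_inj.
split=> [Sm|[x <-]]; last by rewrite iE; apply/asboolP/(valP x).
have Sbm : Sb m by exact/asboolP.
by exists (Sub m Sbm : {x | Sb x}); rewrite iE.
Qed.

Lemma exists_quotient : exists (Q : lmodType R) (p : {linear M -> Q}),
  (forall q, exists m, p m = q) /\ forall m, p m = 0 <-> S m.
Proof.
have clS : zmod_closed Sb.
  split; first exact/asboolP.
  move=> x y /asboolP Sx /asboolP Sy; apply/asboolP.
  by rewrite addrC -scaleN1r; exact: SP.
pose I : zmodClosed M := HB.pack Sb (GRing.isZmodClosed.Build _ Sb clS).
have scaleI a x : x \in I -> a *: x \in I.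
  by move=> /asboolP Sx; apply/asboolP; rewrite -[_ *: _]addr0; exact: SP.
have [p pE] := linear_map_of (pi_is_linear scaleI).
exists (quot_lmod scaleI), p; split=> [q|m].
  by exists (repr (q : quot I)); rewrite pE reprK.
have pi_eq0 : (m \in I) = (\pi_(quot I) m == \pi_(quot I) 0).
  by rewrite -Quotient.idealrBE subr0.
rewrite pE; split=> [pm0|Sm].
  have : m \in I by rewrite pi_eq0; apply/eqP; rewrite raddf0; exact: pm0.
  by move=> /asboolP.
have : m \in I by exact/asboolP.
by rewrite pi_eq0 => /eqP->; exact: raddf0.
Qed.
End Sub.

(** * Short exact sequences, pullbacks and pushouts *)

Definition ses A B C (i : {linear A -> B}) (p : {linear B -> C}) : Prop :=
  [/\ injective i, exact_at i p & forall c, exists b, p b = c].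

Lemma linear_injP A B (f : {linear A -> B}) :
  injective f <-> forall x, f x = 0 -> x = 0.
Proof.
split=> [f_inj x fx|f0 x y fxy]; first by apply: f_inj; rewrite fx linear0.
by apply/subr0_eq/f0; rewrite linearB fxy subrr.
Qed.

Lemma ses_comp0 A B C (i : {linear A -> B}) (p : {linear B -> C}) a :
  ses i p -> p (i a) = 0.
Proof. by case=> _ exi _; apply/exi; exists a. Qed.

Lemma exists_kernel A B (f : {linear A -> B}) :
  exists (K : lmodType R) (i : {linear K -> A}), injective i /\ exact_at i f.
Proof.
apply: (@exists_submodule A (fun x => f x = 0)); first exact: linear0.
by move=> a x y fx fy; rewrite linearP fx fy scaler0 addr0.
Qed.

Lemma exists_cokernel A B (f : {linear A -> B}) :
  exists (C : lmodType R) (p : {linear B -> C}), (forall c, exists b, p b = c) /\ exact_at f p.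
Proof.
apply: (@exists_quotient B (fun y => exists x, f x = y)).
  by exists 0; rewrite linear0.
by move=> a _ _ [x <-] [y <-]; exists (a *: x + y); rewrite linearP.
Qed.

Lemma lift_injective A B X (i : {linear A -> B}) (f : {linear X -> B}) :
    injective i -> (forall x, exists a, i a = f x) ->
  exists h : {linear X -> A}, forall x, i (h x) = f x.
Proof.
move=> i_inj if_; apply: (linear_map_of_graph (r := fun x a => i a = f x)) => //.
  by move=> y; rewrite linear0; apply: (linear_injP i).1.
by move=> a x x' y y' fx fx'; rewrite !linearP fx fx'.
Qed.

Lemma factor_surjective A B X (p : {linear A -> B}) (f : {linear A -> X}) :
    (forall b, exists a, p a = b) -> (forall a, p a = 0 -> f a = 0) ->
  exists h : {linear B -> X}, forall a, h (p a) = f a.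
Proof.
move=> p_surj pf.
have [|y [a [pa <-]]|a x x' y y' [u [<- <-]] [v [<- <-]]|h hE] :=
    @linear_map_of_graph B X (fun b y => exists a, p a = b /\ f a = y).
- by move=> b; have [a pa] := p_surj b; exists (f a), a.
- exact: pf.
- by exists (a *: u + v); rewrite !linearP.
exists h => a; have [a' [pa' <-]] := hE (p a).
by apply/subr0_eq; rewrite -linearB; apply: pf; rewrite linearB pa' subrr.
Qed.

Lemma exists_pair A B X (f : {linear X -> A}) (g : {linear X -> B}) :
  exists h : {linear X -> (A * B)%type}, forall x, h x = (f x, g x).
Proof. by apply: linear_map_of => a x y; rewrite !linearP. Qed.

Lemma exists_copair A B X (f : {linear A -> X}) (g : {linear B -> X}) :
  exists h : {linear (A * B)%type -> X}, forall u, h u = f u.1 + g u.2.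
Proof.
by apply: linear_map_of => a x y; rewrite !linearP /= scalerDr addrACA.
Qed.

Lemma exists_injections A B :
  exists (inl : {linear A -> (A * B)%type}) (inr : {linear B -> (A * B)%type}),
    forall x y, inl x + inr y = (x, y).
Proof.
have [inl inlE] := exists_pair (idfun : {linear A -> A}) (\0 : {linear A -> B}).
have [inr inrE] := exists_pair (\0 : {linear B -> A}) (idfun : {linear B -> B}).
exists inl, inr => x y; rewrite inlE inrE -[in RHS](addr0 x).
by rewrite -[in RHS](add0r y).
Qed.

(** Stated on elements rather than as a universal property, which suits
    diagram chasing; [pullback_map] recovers the universal property. *)
Definition is_pullback A B C E (f : {linear A -> C}) (g : {linear B -> C})
    (c : {linear E -> A}) (d : {linear E -> B}) : Prop :=
  [/\ forall e, f (c e) = g (d e), forall e, c e = 0 -> d e = 0 -> e = 0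
    & forall a b, f a = g b -> exists e, c e = a /\ d e = b].

Lemma exists_pullback A B C (f : {linear A -> C}) (g : {linear B -> C}) :
  exists (E : lmodType R) (c : {linear E -> A}) (d : {linear E -> B}), is_pullback f g c d.
Proof.
have [|a x y fx fy|E [i [i_inj iE]]] :=
    @exists_submodule (A * B)%type (fun u => f u.1 = g u.2).
- by rewrite !linear0.
- by rewrite !linearP fx fy.
exists E, (fst \o i), (snd \o i); split=> [e|e ce de|a b fg] /=.
- by apply/iE; exists e.
- by apply: ((linear_injP i).1 i_inj); move: ce de => /=; case: (i e) => u v /= -> ->.
- by have [e ie] := (iE (a, b)).1 fg; exists e; rewrite ie.
Qed.

Lemma pullback_map A B C E (f : {linear A -> C}) (g : {linear B -> C})
    (c : {linear E -> A}) (d : {linear E -> B}) X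
    (u : {linear X -> A}) (v : {linear X -> B}) :
  is_pullback f g c d -> (forall x, f (u x) = g (v x)) ->
  exists h : {linear X -> E}, forall x, c (h x) = u x /\ d (h x) = v x.
Proof.
move=> [_ inj_cd ex_cd] fugv.
apply: (@linear_map_of_graph X E (fun x e => c e = u x /\ d e = v x)).
- by move=> x; apply: ex_cd.
- by move=> e; rewrite !linear0 => -[]; apply: inj_cd.
- by move=> a x x' y y' [cy dy] [cy' dy']; rewrite !linearP cy dy cy' dy'.
Qed.

Lemma pullback_sym A B C E (f : {linear A -> C}) (g : {linear B -> C})
    (c : {linear E -> A}) (d : {linear E -> B}) :
  is_pullback f g c d -> is_pullback g f d c.
Proof.
move=> [com inj_cd ex_cd]; split=> [e|e de ce|b a gf]; first by rewrite com.
  exact: inj_cd.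
by have [e [ce de]] := ex_cd a b (esym gf); exists e.
Qed.

Lemma pullback_ses K A B C E (k : {linear K -> A})
    (f : {linear A -> C}) (g : {linear B -> C})
    (c : {linear E -> A}) (d : {linear E -> B}) :
    ses k f -> is_pullback f g c d ->
  exists a : {linear K -> E}, ses a d /\ forall x, c (a x) = k x.
Proof.
move=> kf pb; have [com inj_cd ex_cd] := pb; have [k_inj exk f_surj] := kf.
have [x|a aE] := @pullback_map _ _ _ _ _ _ _ _ _ k \0 pb.
  by rewrite linear0 (ses_comp0 _ kf).
exists a; split=> [|x]; last by have [] := aE x.
split=> [|e|b].
- apply/linear_injP => x ax; apply: ((linear_injP k).1 k_inj).
  by have [<- _] := aE x; rewrite ax linear0.
- split=> [de|[x <-]]; last by have [] := aE x.
  have [x kx] : exists x, k x = c e by apply/exk; rewrite com de linear0.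
  exists x; apply/subr0_eq/inj_cd; rewrite linearB; have [cx dx] := aE x.
    by rewrite cx kx subrr.
  by rewrite dx de subrr.
- have [a' fa] := f_surj (g b).
  by have [e [_ de]] := ex_cd _ _ fa; exists e.
Qed.

(** Dually, on elements: [E] is generated by the images of [A] and [B], with
    the images of [K] as only relations. *)
Definition is_pushout K A B E (u : {linear K -> A}) (v : {linear K -> B})
    (a : {linear A -> E}) (b : {linear B -> E}) : Prop :=
  [/\ forall k, a (u k) = b (v k), forall e, exists x y, e = a x + b y
    & forall x y, a x + b y = 0 -> exists k, x = u k /\ y = - v k].

Lemma exists_pushout K A B (u : {linear K -> A}) (v : {linear K -> B}) :
  exists (E : lmodType R) (a : {linear A -> E}) (b : {linear B -> E}), is_pushout u v a b.
Proof.
have [w wE] : exists w : {linear K -> (A * B)%type}, forall k, w k = (u k, - v k).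
  by apply: linear_map_of => a x y; rewrite !linearP.
have [E [p [p_surj exw]]] := exists_cokernel w.
have [inl [inr inlrE]] := exists_injections A B.
have abE x y : p (inl x) + p (inr y) = p (x, y) by rewrite -linearD inlrE.
exists E, (p \o inl), (p \o inr); split=> [k|e|x y] /=.
- have := abE (u k) (- v k); rewrite !linearN => abN; apply/subr0_eq.
  by rewrite abN; apply/exw; exists k; exact: wE.
- by have [[x y] pxy] := p_surj e; exists x, y; rewrite abE.
- by rewrite abE => /exw[k]; rewrite wE => -[<- <-]; exists k.
Qed.

Lemma pushout_sym K A B E (u : {linear K -> A}) (v : {linear K -> B})
    (a : {linear A -> E}) (b : {linear B -> E}) :
  is_pushout u v a b -> is_pushout v u b a.
Proof.
move=> [com ex_ab ker_ab]; split=> [k|e|y x]; first by rewrite com.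
  by have [x [y ->]] := ex_ab e; exists y, x; rewrite addrC.
rewrite addrC => /ker_ab[k [-> ->]]; exists (- k).
by rewrite !linearN opprK.
Qed.

Lemma pushout_ses K A B E M (u : {linear K -> A}) (v : {linear K -> B})
    (a : {linear A -> E}) (b : {linear B -> E}) (w : {linear A -> M}) :
    ses u w -> is_pushout u v a b ->
  exists d : {linear E -> M}, ses b d /\ forall x, d (a x) = w x.
Proof.
move=> uw [com ex_ab ker_ab]; have [u_inj exu w_surj] := uw.
have [e|m [x [y [/esym/ker_ab[k [-> _]] ->]]]||d dE] := @linear_map_of_graph E M
    (fun e m => exists x y, e = a x + b y /\ m = w x).
- by have [x [y ->]] := ex_ab e; exists (w x), x, y.
- exact: (ses_comp0 _ uw).
- move=> z _ _ _ _ [x [y [-> ->]]] [x' [y' [-> ->]]].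
  by exists (z *: x + x'), (z *: y + y'); rewrite !linearP scalerDr addrACA.
have dab x y : d (a x + b y) = w x.
  have [x' [y' [ab ->]]] := dE (a x + b y).
  have [k [xk _]] : exists k, x' - x = u k /\ y' - y = - v k.
    apply: ker_ab; rewrite !linearB addrACA -opprD ab subrr //.
  by apply/subr0_eq; rewrite -linearB xk (ses_comp0 _ uw).
have da x : d (a x) = w x by rewrite -(dab x 0) linear0 addr0.
have db y : d (b y) = 0 by rewrite -[b y]add0r -(linear0 a) dab linear0.
exists d; split=> //; split=> [|e|m].
- apply/linear_injP => y bY; have [|k [k0 ->]] := ker_ab 0 y.
    by rewrite linear0 add0r.
  by rewrite ((linear_injP u).1 u_inj k) ?linear0 ?oppr0.
- split=> [|[y <-] //]; have [x [y ->]] := ex_ab e.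
  rewrite dab => /exu[k <-]; exists (v k + y).
  by rewrite linearD com.
- by have [x <-] := w_surj m; exists (a x).
Qed.

(** Third isomorphism theorem: with [L] inside [E] inside [Q], the module [N]
    is Q/L and the sequence is E/L -> Q/L -> Q/E. *)
Lemma ses_quotient L E M Q C (c : {linear L -> E}) (d : {linear E -> M})
    (j : {linear E -> Q}) (q : {linear Q -> C}) :
    ses c d -> ses j q ->
  exists (N : lmodType R) (r : {linear Q -> N}) (s : {linear M -> N}) (t : {linear N -> C}),
    [/\ ses (j \o c) r, ses s t & forall e, s (d e) = r (j e)].
Proof.
move=> cd jq; have [c_inj exc d_surj] := cd; have [j_inj exj q_surj] := jq.
have [N [r [r_surj exr]]] := exists_cokernel (j \o c).
have rjc l : r (j (c l)) = 0 by apply/exr; exists l.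
have [e /exc[y <-]|s sE] := factor_surjective (f := r \o j) d_surj.
  exact: rjc.
have [x /exr[l <-]|t tE] := factor_surjective (f := q) r_surj.
  exact: ses_comp0 jq.
exists N, r, s, t; split=> //; first by split=> //; apply: inj_comp.
split=> [|n|z].
- apply/linear_injP => m; have [e <-] := d_surj m.
  rewrite sE /= => /exr[l /j_inj <-]; exact: ses_comp0 cd.
- split=> [|[m <-]].
    have [x <-] := r_surj n; rewrite tE => /exj[e <-].
    by exists (d e); rewrite sE.
  by have [e <-] := d_surj m; rewrite sE /= tE (ses_comp0 _ jq).
- by have [x <-] := q_surj z; exists (r x); rewrite tE.
Qed.

(** Dual of [ses_quotient]: [N] is the kernel of the composite epimorphism, an
    extension of the two successive kernels. *)
Lemma ses_kernel K Q E P A (k : {linear K -> Q}) (q : {linear Q -> E})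
    (i : {linear P -> E}) (r : {linear E -> A}) :
    ses k q -> ses i r ->
  exists (N : lmodType R) (a : {linear K -> N}) (b : {linear N -> P}) (m : {linear N -> Q}),
    [/\ ses m (r \o q), ses a b & forall x, m (a x) = k x].
Proof.
move=> kq ir; have [k_inj exk q_surj] := kq; have [i_inj exi r_surj] := ir.
have [N [m [b pb]]] := exists_pullback q i.
have [a [ab ma]] := pullback_ses kq pb.
have [com inj_mb ex_mb] := pb.
exists N, a, b, m; split=> //; split=> [|x|z].
- apply/linear_injP => n mn; apply: inj_mb => //.
  by apply: ((linear_injP i).1 i_inj); rewrite -com mn linear0.
- split=> /= [/exi[y iy]|[n <-]]; last by rewrite com (ses_comp0 _ ir).
  by have [n [mn _]] := ex_mb _ _ (esym iy); exists n.
- have [e <-] := r_surj z; have [x <-] := q_surj e; by exists x.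
Qed.

(** * Vanishing of Ext^1 and projective modules *)

(** Ext^1(G, X) = 0, by the long exact sequence of Hom(-, X). *)
Definition ext_trivial G X : Prop :=
  forall A B (i : {linear A -> B}) (p : {linear B -> G}), ses i p ->
  forall g : {linear A -> X}, exists h : {linear B -> X}, forall a, h (i a) = g a.

Lemma projective_lift P A B (g : {linear A -> B}) (f : {linear P -> B}) :
  projective P -> (forall b, exists a, g a = b) ->
  exists h : {linear P -> A}, forall x, g (h x) = f x.
Proof. by move=> projP /(projP _ _ _ f). Qed.

(** Ext^1(G, X) can be computed from one projective presentation of [G]: any
    other sequence A -> B -> G receives a map from it by projectivity, and
    makes [B] a quotient of [A * Q]. *)
Lemma ext_trivial_of_presentation K Q G X (k : {linear K -> Q})
    (q : {linear Q -> G}) :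
    projective Q -> ses k q ->
    (forall g : {linear K -> X}, exists h : {linear Q -> X}, forall a, h (k a) = g a) ->
  ext_trivial G X.
Proof.
move=> projQ kq extk A B i p ip g.
have [k_inj exk q_surj] := kq; have [i_inj exi p_surj] := ip.
have [t tE] := projective_lift q projQ p_surj.
have [x|w wE] := lift_injective (f := t \o k) i_inj.
  by apply/exi; rewrite /= tE (ses_comp0 _ kq).
have [h hE] := extk (g \o w).
have [c cE] := exists_copair i t; have [d dE] := exists_copair g h.
have [b||f fE] := factor_surjective (p := c) (f := d).
- have [x qx] := q_surj (p b).
  have [a ia] : exists a, i a = b - t x by apply/exi; rewrite linearB tE qx subrr.
  by exists (a, x); rewrite cE /= ia subrK.
- move=> [a x]; rewrite cE dE /= => ab.
  have [z zx] : exists z, k z = x.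
    by apply/exk; rewrite -tE; have := congr1 p ab;
       rewrite linearD (ses_comp0 _ ip) add0r linear0.
  have -> : a = - w z.
    apply: i_inj; rewrite linearN wE /= zx; apply/eqP.
    by rewrite -addr_eq0 ab.
  by rewrite -zx hE /= linearN addNr.
exists f => a; have := fE (a, 0); rewrite cE dE /= !linear0 !addr0; exact.
Qed.

(** Any module serves to produce a zero module, with which the trivial
    presentation of [P] is a short exact sequence. *)
Lemma ses_id0 P : exists (Z : lmodType R) (z : {linear Z -> P}), ses z (idfun : {linear P -> P}).
Proof.
have [Z [z [z_inj exz]]] := exists_kernel (idfun : {linear P -> P}).
by exists Z, z; split=> // x; exists x.
Qed.

Lemma projective_ext_trivial P X : projective P -> ext_trivial P X.
Proof.
move=> projP; have [Z [z zid]] := ses_id0 P.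
apply: (ext_trivial_of_presentation projP zid) => g; exists \0 => a.
have [z_inj _ _] := zid.
by rewrite ((linear_injP z).1 z_inj a) ?linear0 //; exact: (ses_comp0 a zid).
Qed.

(** Extend first over the preimage of [A], then over the whole module. *)
Lemma ext_trivial_extension A E B X (i : {linear A -> E}) (p : {linear E -> B}) :
  ses i p -> ext_trivial A X -> ext_trivial B X -> ext_trivial E X.
Proof.
move=> ip extA extB U V u v uv g.
have [N [a [b [m [mN ab ma]]]]] := ses_kernel uv ip.
have [f fE] := extA _ _ _ _ ab g; have [h hE] := extB _ _ _ _ mN f.
by exists h => x; rewrite -ma hE.
Qed.

(** The retraction [r] extends the identity of [A], and [s] identifies [P] with
    its kernel. *)
Lemma ses_split A E P (i : {linear A -> E}) (p : {linear E -> P}) :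
    ses i p -> ext_trivial P A ->
  exists (s : {linear P -> E}) (r : {linear E -> A}),
    [/\ ses s r, forall a, r (i a) = a & forall x, p (s x) = x].
Proof.
move=> ip extPA; have [i_inj exi p_surj] := ip.
have [r ri] := extPA _ _ _ _ ip idfun.
have {ri} rE a : r (i a) = a by exact: ri.
have [x|e [pe re]||s sE] := @linear_map_of_graph P E (fun x e => p e = x /\ r e = 0).
- have [e pe] := p_surj x; exists (e - i (r e)).
  by rewrite !linearB (ses_comp0 _ ip) subr0 rE subrr.
- by have [a ia] := (exi e).1 pe; rewrite -ia -[a]rE ia re linear0.
- by move=> a x x' y y' [px rx] [px' rx']; rewrite !linearP px rx px' rx' scaler0 addr0.
exists s, r; split=> // [|x]; last by have [] := sE x.
split=> [|e|a]; last by exists (i a); rewrite rE.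
- by apply/linear_injP => x sx; have [<- _] := sE x; rewrite sx linear0.
- split=> [re|[x <-]]; last by have [] := sE x.
  exists (p e); apply/subr0_eq; have [ps rs] := sE (p e).
  have [a ia] : exists a, i a = s (p e) - e by apply/exi; rewrite linearB ps subrr.
  by rewrite -ia -[a]rE ia linearB rs re subrr linear0.
Qed.

Lemma projective_retract P A (s : {linear A -> P}) (r : {linear P -> A}) :
  (forall a, r (s a) = a) -> projective P -> projective A.
Proof.
move=> rs projP B C g f g_surj.
have [h hE] := projective_lift (f \o r) projP g_surj.
by exists (h \o s) => a /=; rewrite hE /= rs.
Qed.

Lemma projective_zero Z : (forall z : Z, z = 0) -> projective Z.
Proof. by move=> Z0 A B g f _; exists \0 => z; rewrite (Z0 z) !linear0. Qed.

Lemma projective_prod P Q :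
  projective P -> projective Q -> projective (P * Q)%type.
Proof.
move=> projP projQ A B g f g_surj.
have [inl [inr inlrE]] := exists_injections P Q.
have [h1 h1E] := projective_lift (f \o inl) projP g_surj.
have [h2 h2E] := projective_lift (f \o inr) projQ g_surj.
have [h hE] := exists_copair h1 h2; exists h => -[x y] /=.
by rewrite hE linearD h1E h2E /= -linearD inlrE.
Qed.

End Modules.

(** * Complexes and splicing *)

Section Splicing.
Variable R : nzRingType.
Implicit Types A B C D E F G H K L M N P Q X Z : lmodType R.

Lemma splice_exact D A B C E (q : {linear D -> A}) (i : {linear A -> B})
    (p : {linear B -> C}) (j : {linear C -> E}) :
  (forall a, exists d, q d = a) -> ses i p -> injective j ->
  exact_at (i \o q) (j \o p).
Proof.
move=> q_surj ip /linear_injP j0 b; have [_ exi _] := ip; split=> /= [/j0|[d <-]].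
  by move=> /exi[a <-]; have [d <-] := q_surj a; exists d.
by rewrite (ses_comp0 _ ip) linear0.
Qed.

(** Hom(-, X) turns the spliced pair into an exact one as soon as the map that
    is induced on [C] extends along [j], that is, when Ext^1(F, X) = 0 for the
    next cycle [F]. *)
Lemma splice_hom_exact D A B C E F X (q : {linear D -> A}) (i : {linear A -> B})
    (p : {linear B -> C}) (j : {linear C -> E}) (r : {linear E -> F}) :
    (forall a, exists d, q d = a) -> ses i p -> ses j r -> ext_trivial F X ->
  hom_exact_at (i \o q) (j \o p) X.
Proof.
move=> q_surj ip jr extF h; have [_ exi p_surj] := ip; split=> /= [hq|[k kE] d].
  have [b /exi[a <-]|f fE] := factor_surjective (f := h) p_surj.
    by have [d <-] := q_surj a.
  by have [k kE] := extF _ _ _ _ jr f; exists k => b /=; rewrite kE fE.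
by rewrite -kE /= (ses_comp0 _ ip) !linear0.
Qed.

Definition shift_left (S : sequence R) : sequence R :=
  @Sequence R (fun n => left_obj S n.+1)
    (fun n => if n is m.+1 then right_obj S m else left_obj S 0)
    (fun n => left_map S n.+1) (left_map S 0)
    (fun n => if n is m.+1 then right_map S m else mid_map S).

Definition shift_right (S : sequence R) : sequence R :=
  @Sequence R (fun n => if n is m.+1 then left_obj S m else right_obj S 0)
    (fun n => right_obj S n.+1)
    (fun n => if n is m.+1 then left_map S m else mid_map S)
    (right_map S 0) (fun n => right_map S n.+1).

Lemma at_all_terms_shift_left (S : sequence R)
    (E : forall A B C, {linear A -> B} -> {linear B -> C} -> Prop) :
  at_all_terms S E -> at_all_terms (shift_left S) E.
Proof.
move=> [left mid_l mid_r right]; split=> [n|||[|n]].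
- exact: (left n.+1).
- exact: (left 0).
- exact: mid_l.
- exact: mid_r.
- exact: (right n).
Qed.

Lemma at_all_terms_shift_right (S : sequence R)
    (E : forall A B C, {linear A -> B} -> {linear B -> C} -> Prop) :
  at_all_terms S E -> at_all_terms (shift_right S) E.
Proof.
move=> [left mid_l mid_r right]; split=> [[|n]|||n].
- exact: mid_l.
- exact: (left n).
- exact: mid_r.
- exact: (right 0).
- exact: (right n.+1).
Qed.

Section Class.
Variable cl : module_class R.

(** Records in [Type] rather than existential statements, because splicing
    needs a choice of syzygy and cosyzygy for every member of the class. *)
Record presentation H := Presentation {
  pres_ker : lmodType R;
  pres_mid : lmodType R;
  pres_in : {linear pres_ker -> pres_mid};
  pres_out : {linear pres_mid -> H};
  pres_class : cl pres_ker;
  pres_projective : projective pres_mid;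
  pres_ses : ses pres_in pres_out }.

Record copresentation H := Copresentation {
  copres_mid : lmodType R;
  copres_coker : lmodType R;
  copres_in : {linear H -> copres_mid};
  copres_out : {linear copres_mid -> copres_coker};
  copres_class : cl copres_coker;
  copres_projective : projective copres_mid;
  copres_ses : ses copres_in copres_out }.

Section Sequence.
Local Notation member := {H : lmodType R | cl H}.
Variables (pres : forall u : member, presentation (sval u))
          (copres : forall u : member, copresentation (sval u)).

Definition syz (u : member) : member := exist cl _ (pres_class (pres u)).
Definition cosyz (u : member) : member := exist cl _ (copres_class (copres u)).
Variable G : member.
Let lft n := iter n syz G.
Let rgt n := iter n cosyz G.

(** The middle map has to have kernel [G], so the copresentation of [G] itself
    sits in degree 0 on the left and the right half starts at its cosyzygy. *)
Definition spliced_sequence : sequence R :=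
  @Sequence R
    (fun n => if n is m.+1 then pres_mid (pres (lft m)) else copres_mid (copres G))
    (fun n => copres_mid (copres (rgt n.+1)))
    (fun n => match n with
      | 0 => copres_in (copres G) \o pres_out (pres G)
      | m.+1 => pres_in (pres (lft m)) \o pres_out (pres (lft m.+1))
      end)
    (copres_in (copres (rgt 1)) \o copres_out (copres G))
    (fun n => copres_in (copres (rgt n.+2)) \o copres_out (copres (rgt n.+1))).

Lemma spliced_projective : projective_terms spliced_sequence.
Proof.
move=> n; split; last exact: copres_projective.
by case: n => [|n]; [exact: copres_projective|exact: pres_projective].
Qed.

Lemma spliced_exact : exact spliced_sequence.
Proof.
have cs u := pres_ses (pres u); have es u := copres_ses (copres u).
split=> [[|n]|||n]; apply: splice_exact.
- by have [] := cs (lft 1).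
- exact: cs.
- by have [] := es G.
- by have [] := cs (lft n.+2).
- exact: cs.
- by have [] := cs (lft n).
- by have [] := cs G.
- exact: es.
- by have [] := es (rgt 1).
- by have [] := es G.
- exact: es (rgt 1).
- by have [] := es (rgt 2).
- by have [] := es (rgt n.+1).
- exact: es (rgt n.+2).
- by have [] := es (rgt n.+3).
Qed.

Lemma spliced_hom_exact X :
  (forall H, cl H -> ext_trivial H X) -> hom_exact spliced_sequence X.
Proof.
move=> ext_cl; have cs u := pres_ses (pres u); have es u := copres_ses (copres u).
split=> [[|n]|||n].
- apply: (splice_hom_exact _ (cs G) (es G) (ext_cl _ (svalP (rgt 1)))).
  by have [] := cs (lft 1).
- apply: (splice_hom_exact _ (cs (lft n.+1)) (cs (lft n)) (ext_cl _ (svalP (lft n)))).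
  by have [] := cs (lft n.+2).
- apply: (splice_hom_exact _ (es G) (es (rgt 1)) (ext_cl _ (svalP (rgt 2)))).
  by have [] := cs G.
- apply: (splice_hom_exact _ (es (rgt 1)) (es (rgt 2)) (ext_cl _ (svalP (rgt 3)))).
  by have [] := es G.
- apply: (splice_hom_exact _ (es (rgt n.+2)) (es (rgt n.+3))
    (ext_cl _ (svalP (rgt n.+4)))).
  by have [] := es (rgt n.+1).
Qed.

Lemma spliced_kernel : is_kernel (sval G) (mid_map spliced_sequence).
Proof.
have [i_inj exi _] := copres_ses (copres G); have [/linear_injP j0 _ _] := copres_ses (copres (rgt 1)).
exists (copres_in (copres G)); split=> // x; split=> [/j0/exi|/exi /= ->] //.
by rewrite linear0.
Qed.

End Sequence.
End Class.
End Splicing.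

(** * The class of Gorenstein projective modules *)

Section Gorenstein.
Variables (R : nzRingType) (X : module_class R).
Hypothesis proj_X : forall P : lmodType R, projective P -> X P.
Implicit Types A B C D E F G H K L M N P Q Y Z : lmodType R.

Local Notation GP := (X_Gorenstein_projective X).

Definition has_syzygy (cl : module_class R) H : Prop :=
  exists K P (i : {linear K -> P}) (p : {linear P -> H}),
    [/\ cl K, projective P & ses i p].

Definition has_cosyzygy (cl : module_class R) H : Prop :=
  exists P C (i : {linear H -> P}) (p : {linear P -> C}),
    [/\ cl C, projective P & ses i p].

(** The property of a class that makes it consist of Gorenstein projective
    modules: the syzygies and cosyzygies of its members can be iterated without
    leaving the class, and the sequences so obtained stay exact under
    Hom(-, Y). *)
Definition coresolving (cl : module_class R) : Prop :=
  forall H, cl H -> [/\ forall Y, X Y -> ext_trivial H Y,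
    has_syzygy cl H & has_cosyzygy cl H].

Lemma coresolving_GP (cl : module_class R) H : coresolving cl -> cl H -> GP H.
Proof.
move=> cl_co clH; pose member := {H : lmodType R | cl H}.
have pres (u : member) : presentation cl (sval u).
  have : exists c : presentation cl (sval u), True.
    have [_ [K [P [i [p [clK projP ip]]]]] _] := cl_co _ (svalP u).
    by exists (Presentation clK projP ip).
  by move=> /cid[].
have copres (u : member) : copresentation cl (sval u).
  have : exists c : copresentation cl (sval u), True.
    have [_ _ [P [C [i [p [clC projP ip]]]]]] := cl_co _ (svalP u).
    by exists (Copresentation clC projP ip).
  by move=> /cid[].
exists (spliced_sequence pres copres (exist cl H clH)); split.
- exact: spliced_projective.
- exact: spliced_exact.
- by move=> Y XY; apply: spliced_hom_exact => K /cl_co[ext _ _]; exact: ext.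
- exact: (spliced_kernel pres copres (exist cl H clH)).
Qed.

(** The syzygy and the cosyzygy of [H] are the kernels next to it in the
    complex, so they are Gorenstein projective by shifting the complex.  That
    Hom(-, Y) is exact at the second term on the left says that maps from the
    syzygy to [Y] extend to the first term. *)
Lemma GP_coresolving : coresolving GP.
Proof.
move=> H [S [projS exS homS [iota [iota_inj iotaE]]]].
have [ex_l ex_ml ex_mr ex_r] := exS.
have [p pE] : exists p : {linear left_obj S 1 -> H},
    forall x, iota (p x) = left_map S 0 x.
  by apply: lift_injective => // x; apply/iotaE/ex_ml; exists x.
have [K [k [k_inj exk]]] := exists_kernel (left_map S 0).
have kp : ses k p.
  split=> // [x|h].
    split=> [px|/exk kx]; first by apply/exk; rewrite -pE px linear0.
    by apply: iota_inj; rewrite pE kx linear0.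
  have [x xh] : exists x, left_map S 0 x = iota h.
    by apply/ex_ml/iotaE; exists h.
  by exists x; apply: iota_inj; rewrite pE.
split.
- move=> Y XY; apply: (ext_trivial_of_presentation (projS 1%N).1 kp) => g.
  have [w wE] : exists w : {linear left_obj S 2 -> K},
      forall x, k (w x) = left_map S 1 x.
    by apply: lift_injective => // x; apply/exk/ex_l; exists x.
  have [hom_l _ _ _] := homS Y XY.
  have [x|f fE] := (hom_l 1%N (g \o w)).1.
    rewrite /= [w _](_ : _ = 0) ?linear0 //; apply: k_inj.
    by rewrite wE linear0; apply/ex_l; exists x.
  exists f => x; have [y xy] : exists y, left_map S 1 y = k x.
    by apply/ex_l/exk; exists x.
  have -> : x = w y by apply: k_inj; rewrite wE.
  by rewrite wE; exact: fE.
- exists K, (left_obj S 1), k, p; split=> //; last exact: (projS 1%N).1.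
  exists (shift_left S); split; last by exists k.
  + by case=> [|n]; split; [exact: (projS _).1|exact: (projS _).1
      |exact: (projS _).1|exact: (projS _).2].
  + exact: at_all_terms_shift_left.
  + by move=> Y /homS; exact: at_all_terms_shift_left.
- have [C [c [c_inj exc]]] := exists_kernel (right_map S 0).
  have [q qE] : exists q : {linear left_obj S 0 -> C},
      forall x, c (q x) = mid_map S x.
    by apply: lift_injective => // x; apply/exc/ex_mr; exists x.
  exists (left_obj S 0), C, iota, q; split; last 1 first.
  + split=> // [x|y].
      split=> [qx|/iotaE mx]; first by apply/iotaE; rewrite -qE qx linear0.
      by apply: c_inj; rewrite qE mx linear0.
    have [x xy] : exists x, mid_map S x = c y by apply/ex_mr/exc; exists y.
    by exists x; apply: c_inj; rewrite qE.
  + exists (shift_right S); split; last by exists c.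
    * by case=> [|n]; split; [exact: (projS _).2|exact: (projS _).2
        |exact: (projS _).1|exact: (projS _).2].
    * exact: at_all_terms_shift_right.
    * by move=> Y /homS; exact: at_all_terms_shift_right.
  + exact: (projS 0%N).1.
Qed.

(** One step of the coinduction can be stripped off: adding to GP the modules
    that satisfy the one-step conditions over GP gives a coresolving class. *)
Lemma GP_intro H :
    (forall Y, X Y -> ext_trivial H Y) -> has_syzygy GP H -> has_cosyzygy GP H ->
  GP H.
Proof.
move=> extH syzH cosyzH.
apply: (@coresolving_GP (fun H => GP H \/ [/\ forall Y, X Y -> ext_trivial H Y,
  has_syzygy GP H & has_cosyzygy GP H])); last by right.
move=> M GPM; have {GPM} [ext_M [K [P [i [p [gK prP ip]]]]] [Q [C [j [q [gC prQ jq]]]]]] :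
    [/\ forall Y, X Y -> ext_trivial M Y, has_syzygy GP M & has_cosyzygy GP M].
  by case: GPM => // /GP_coresolving.
split=> //; first by exists K, P, i, p; split=> //; left.
by exists Q, C, j, q; split=> //; left.
Qed.

Lemma GP_ext_trivial G Y : GP G -> X Y -> ext_trivial G Y.
Proof. by move=> /GP_coresolving[extG _ _]; exact: extG. Qed.

Lemma projective_GP P : projective P -> GP P.
Proof.
move=> projP; apply: (coresolving_GP (cl := @projective R)) => // {}P {}projP.
split=> [Y _||]; first exact: projective_ext_trivial.
  have [Z [z zid]] := ses_id0 P; exists Z, P, z, idfun; split=> //.
  apply: projective_zero => x; have [z_inj _ _] := zid.
  by apply: ((linear_injP z).1 z_inj); exact: (ses_comp0 x zid).
have [C [c [c_surj exc]]] := exists_cokernel (idfun : {linear P -> P}).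
exists P, C, idfun, c; split=> //; last by split=> // x y.
apply: projective_zero => x; have [y <-] := c_surj x.
by apply/exc; exists y.
Qed.

Definition extension_of_GPs E : Prop :=
  exists A B (i : {linear A -> E}) (p : {linear E -> B}),
    [/\ GP A, GP B & ses i p].

(** Horseshoe lemma: the sum of the two presentations is a presentation of [E],
    and its kernel is an extension of the two syzygies. *)
Lemma syzygy_extension A E B (i : {linear A -> E}) (p : {linear E -> B}) :
    ses i p -> has_syzygy GP A -> has_syzygy GP B ->
  has_syzygy extension_of_GPs E.
Proof.
move=> ip [KA [PA [iA [pA [gKA prA sesA]]]]] [KB [PB [iB [pB [gKB prB sesB]]]]].
have [i_inj exi p_surj] := ip.
have [iA_inj exA pA_surj] := sesA; have [iB_inj exB pB_surj] := sesB.
have [t tE] := projective_lift pB prB p_surj.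
have [c cE] := exists_copair (i \o pA) t.
have [K [k [k_inj exk]]] := exists_kernel c.
have pc u : p (c u) = pB u.2 by rewrite cE linearD (ses_comp0 _ ip) add0r tE.
have [l lE] := exists_pair iA (\0 : {linear KA -> PB}).
have [x|a aE] := lift_injective (f := l) k_inj.
  by apply/exk; rewrite lE cE /= (ses_comp0 _ sesA) !linear0 addr0.
have [y|b bE] := lift_injective (f := snd \o k) iB_inj.
  apply/exB => /=; rewrite -pc (_ : c (k y) = 0) ?linear0 //.
  by apply/exk; exists y.
exists K, (PA * PB)%type, k, c; split; last 1 first.
- split=> // e; have [v pv] := pB_surj (p e).
  have [a' ia] : exists a', i a' = e - t v by apply/exi; rewrite linearB tE pv subrr.
  by have [u pu] := pA_surj a'; exists (u, v); rewrite cE /= pu ia subrK.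
- exists KA, KB, a, b; split=> //; split=> [|y|z].
  + apply/linear_injP => x ax; apply: ((linear_injP iA).1 iA_inj).
    by have := aE x; rewrite ax linear0 lE => -[].
  + split=> [b_y|[x <-]]; last first.
      by apply: iB_inj; rewrite bE /= aE lE linear0.
    have ky2 : (k y).2 = 0 by have := bE y; rewrite b_y linear0.
    have : c (k y) = 0 by apply/exk; exists y.
    rewrite cE ky2 linear0 addr0 /= => /((linear_injP i).1 i_inj)/exA[x iAx].
    exists x; apply: k_inj; rewrite aE lE iAx.
    by case: (k y) ky2 => u v /= ->.
  + have [a' ia] : exists a', i a' = t (iB z).
      by apply/exi; rewrite tE (ses_comp0 _ sesB).
    have [u pu] := pA_surj a'.
    have [y ky] : exists y, k y = (- u, iB z).
      by apply/exk; rewrite cE /= !linearN pu ia addNr.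
    by exists y; apply: iB_inj; rewrite bE /= ky.
- exact: projective_prod.
Qed.

(** The dual horseshoe: projective modules are not injective, but the embedding
    of [A] extends to [E] because Ext^1(B, -) vanishes on projectives.  This is
    where [X] must contain them. *)
Lemma cosyzygy_extension A E B (i : {linear A -> E}) (p : {linear E -> B}) :
    ses i p -> GP B -> has_cosyzygy GP A -> has_cosyzygy GP B ->
  has_cosyzygy extension_of_GPs E.
Proof.
move=> ip gB [QA [CA [jA [qA [gCA prA sesA]]]]] [QB [CB [jB [qB [gCB prB sesB]]]]].
have [i_inj exi p_surj] := ip.
have [jA_inj exA qA_surj] := sesA; have [jB_inj exB qB_surj] := sesB.
have [e eE] := GP_ext_trivial gB (proj_X prA) ip jA.
have [phi phiE] := exists_pair e (jB \o p).
have [C [c [c_surj exc]]] := exists_cokernel phi.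
have [l lE] := exists_pair (idfun : {linear QA -> QA}) (\0 : {linear QA -> QB}).
have cphi x : c (phi x) = 0 by apply/exc; exists x.
have phii a : phi (i a) = l (jA a).
  by rewrite phiE lE eE /= (ses_comp0 _ ip) linear0.
have [_ /exA[a <-]|s sE] := factor_surjective (f := c \o l) qA_surj.
  by rewrite /= -phii.
have [_ /exc[x <-]|t tE] := factor_surjective (f := qB \o snd) c_surj.
  by rewrite /= phiE /= (ses_comp0 _ sesB).
have phi_inj : injective phi.
  apply/linear_injP => x; rewrite phiE => -[ex].
  move=> /((linear_injP jB).1 jB_inj)/exi[a ia].
  move: ex; rewrite -ia eE => /((linear_injP jA).1 jA_inj)->.
  by rewrite linear0.
exists (QA * QB)%type, C, phi, c; split=> //; last exact: projective_prod.
exists CA, CB, s, t; split=> //; split=> [|z|z].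
- apply/linear_injP => z; have [u <-] := qA_surj z.
  rewrite sE /= => /exc[x]; rewrite phiE lE => -[eu].
  move=> /((linear_injP jB).1 jB_inj)/exi[a ia].
  by apply/exA; exists a; rewrite -eu -ia eE.
- split=> [|[y <-]]; last first.
    by have [u <-] := qA_surj y; rewrite sE /= tE /= lE linear0.
  have [[u v] <-] := c_surj z; rewrite tE /= => /exB[b jb].
  have [x px] := p_surj b; exists (qA (u - e x)).
  rewrite sE /= -[RHS]subr0 -(cphi x) -linearB; congr (c _).
  by rewrite lE phiE /= px jb; congr (_, _); rewrite subrr.
- by have [v <-] := qB_surj z; exists (c (0, v)); rewrite tE.
Qed.

(** Extensions of Gorenstein projective modules form a coresolving class. *)
Lemma GP_extension A E B (i : {linear A -> E}) (p : {linear E -> B}) :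
  ses i p -> GP A -> GP B -> GP E.
Proof.
move=> ip gA gB.
apply: (@coresolving_GP extension_of_GPs); last by exists A, B, i, p.
move=> {}E [{}A [{}B [{}i [{}p [{}gA {}gB {}ip]]]]].
have [extA syzA cosyzA] := GP_coresolving gA.
have [extB syzB cosyzB] := GP_coresolving gB.
split=> [Y XY||].
- by apply: ext_trivial_extension ip _ _; [exact: extA|exact: extB].
- exact: syzygy_extension ip syzA syzB.
- exact: cosyzygy_extension ip gB cosyzA cosyzB.
Qed.

(** Let [E] be the pullback of [p] and of a projective presentation
    PC -> C.  It is an extension of [B] by the syzygy of [C], hence Gorenstein
    projective, and it splits as the sum of [A] and [PC].  The vanishing of Ext^1
    and the syzygy of [A] are inherited from [E]; its cosyzygy is an extension
    of the cosyzygy of [B] by [C]. *)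
Lemma GP_kernel A B C (i : {linear A -> B}) (p : {linear B -> C}) :
  ses i p -> GP B -> GP C -> GP A.
Proof.
move=> ip gB gC.
have [_ [KC [PC [kC [pC [gKC prC sesC]]]]] _] := GP_coresolving gC.
have [E [c [d pb]]] := exists_pullback pC p.
have [_ [/(GP_extension)/(_ gKC gB) gE _]] := pullback_ses sesC pb.
have [i' [i'c _]] := pullback_ses ip (pullback_sym pb).
have [s [r [sr ri _]]] := ses_split i'c (@projective_ext_trivial _ _ _ prC).
apply: GP_intro.
- move=> Y XY U V u v uv g.
  (* Pull the sequence U -> V -> A back along the retraction [r]. *)
  have [F [m [n pbF]]] := exists_pullback v r.
  have [a [an ma]] := pullback_ses uv pbF.
  have [h hE] := GP_ext_trivial gE XY an g.
  have [x|w wE] := pullback_map (u := idfun) (v := i' \o v) pbF.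
    by rewrite /= ri.
  exists (h \o w) => x; rewrite /= -hE; congr (h _).
  have [_ inj_mn _] := pbF; have [_ _ _] := uv.
  have [mw nw] := wE (u x); apply/subr0_eq/inj_mn.
    by rewrite linearB mw ma subrr.
  by rewrite linearB nw /= (ses_comp0 _ uv) (ses_comp0 _ an) linear0 subrr.
- have [_ [KE [QE [kE [qE [gKE prE sesE]]]]] _] := GP_coresolving gE.
  have [N [a [b [m [mN ab _]]]]] := ses_kernel sesE sr.
  exists N, QE, m, (r \o qE); split=> //.
  exact: (GP_extension ab gKE (projective_GP prC)).
- have [_ _ [Q [D [j [q [gD prQ jq]]]]]] := GP_coresolving gB.
  have [N [t [f [g [jt fg _]]]]] := ses_quotient ip jq.
  exists Q, N, (j \o i), t; split=> //; exact: (GP_extension fg gC gD).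
Qed.

End Gorenstein.

(** * Resolutions and finitistic dimensions *)

Section Resolutions.
Variable R : nzRingType.
Implicit Types A B C D E F G H K L M N P Q Y Z : lmodType R.

(** Resolutions unfolded into short exact sequences, for induction on their
    length. *)
Fixpoint resolvable (cl : module_class R) n M : Prop :=
  if n is m.+1 then
    exists K G (i : {linear K -> G}) (p : {linear G -> M}),
      [/\ resolvable cl m K, cl G & ses i p]
  else cl M.

Definition iso_closed (cl : module_class R) : Prop :=
  forall A B (f : {linear A -> B}),
    injective f -> (forall b, exists a, f a = b) -> cl A -> cl B.

Lemma resolvable_has_resolution (cl : module_class R) n M :
  resolvable cl n M -> has_resolution cl M n.
Proof.
elim: n M => [|n IHn] M /=.
  move=> clM; have [Z [z [z_inj exz _]]] := ses_id0 M.
  have Z0 x : x = 0 :> Z.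
    by apply: ((linear_injP z).1 z_inj); apply/exz; exists x.
  pose G i := if i is _.+1 then Z else M.
  exists G, (fun i => \0 : {linear G i.+1 -> G i}), idfun; split=> //.
  - by case.
  - by case.
  - by move=> i x; split=> // _; exists 0; rewrite [x]Z0.
  - by move=> x; split=> [x0|[y <-]] //; exists 0; rewrite [RHS]x0.
  - by move=> x; exists x.
move=> [K [G0 [i [p [/IHn[G [d [aug [clG G0_ exG ex_aug aug_surj]]]] clG0 ip]]]]].
pose G' j := if j is k.+1 then G k else G0.
pose d' j : {linear G' j.+1 -> G' j} :=
  match j return {linear G' j.+1 -> G' j} with
  | 0 => i \o aug
  | k.+1 => d k
  end.
have [/linear_injP i0 exi p_surj] := ip.
exists G', d', p; split=> //.
- by case=> // j; exact: clG.
- by case=> // j; exact: G0_.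
- case=> [|j] x; last exact: exG.
  split=> [/= /i0/ex_aug //|[y <-] /=].
  have ->: aug (d 0%N y) = 0 by apply/ex_aug; exists y.
  exact: linear0.
- move=> x; split=> [/exi[k <-]|[y <-]]; last exact: ses_comp0 ip.
  by have [y <-] := aug_surj k; exists y.
Qed.

Lemma has_resolution_resolvable (cl : module_class R) n M :
  iso_closed cl -> has_resolution cl M n -> resolvable cl n M.
Proof.
move=> cl_iso; elim: n M => [|n IHn] M [G [d [aug [clG G0 exG ex_aug aug_surj]]]] /=.
  apply: (cl_iso _ _ aug _ aug_surj (clG 0%N _)) => //.
  apply/linear_injP => x /ex_aug[y <-].
  by rewrite (G0 1%N isT y) linear0.
have [K [k [k_inj exk]]] := exists_kernel aug.
have [y|e eE] := lift_injective (f := d 0%N) k_inj.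
  by apply/exk/ex_aug; exists y.
exists K, (G 0%N), k, aug; split=> //; last exact: clG.
apply: IHn; exists (fun i => G i.+1), (fun i => d i.+1), e; split=> [i|i|i|x|x].
- exact: (clG i.+1).
- exact: (G0 i.+1).
- exact: (exG i.+1).
- split=> [ex|/exG dx]; first by apply/exG; rewrite -eE ex linear0.
  by apply: k_inj; rewrite eE dx linear0.
- have [y dy] : exists y, d 0%N y = k x by apply/ex_aug/exk; exists x.
  by exists y; apply: k_inj; rewrite eE.
Qed.

Lemma bijective_inverse A B (f : {linear A -> B}) :
    injective f -> (forall b, exists a, f a = b) ->
  exists g : {linear B -> A}, cancel g f.
Proof.
by move=> f_inj f_surj; apply: (lift_injective (f := idfun)).
Qed.

Lemma projective_iso : iso_closed (@projective R).
Proof.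
by move=> A B f f_inj f_surj; have [g gK] := bijective_inverse f_inj f_surj;
  exact: (projective_retract gK).
Qed.

Lemma GP_iso (X : module_class R) : iso_closed (X_Gorenstein_projective X).
Proof.
move=> A B f f_inj f_surj [S [projS exS homS [i [i_inj iE]]]].
have [g gK] := bijective_inverse f_inj f_surj.
exists S; split=> //; exists (i \o g); split.
  exact: inj_comp i_inj (can_inj gK).
move=> x; split=> [/iE[a <-]|[b <-]]; last by apply/iE; exists (g b).
by exists (f a); rewrite /=; congr (i _); apply: f_inj; rewrite gK.
Qed.

Lemma projective_resolvable n P : projective P -> resolvable (@projective R) n P.
Proof.
elim: n P => // n IHn P projP /=; have [Z [z zid]] := ses_id0 P.
exists Z, P, z, idfun; split=> //; apply/IHn/projective_zero => x.
by have [z_inj _ _] := zid; apply: ((linear_injP z).1 z_inj); exact: (ses_comp0 x zid).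
Qed.

Lemma resolvable_sub (cl1 cl2 : module_class R) n M :
  (forall H, cl1 H -> cl2 H) -> resolvable cl1 n M -> resolvable cl2 n M.
Proof.
move=> sub; elim: n M => [M|n IHn M /=]; first exact: sub.
by move=> [K [G [i [p [/IHn resK /sub clG ip]]]]]; exists K, G, i, p.
Qed.

Section Gorenstein.
Variable X : module_class R.
Hypothesis proj_X : forall P : lmodType R, projective P -> X P.
Local Notation GP := (X_Gorenstein_projective X).
Local Notation PD := (resolvable (@projective R)).

(** Replacing the first term of the resolution of [L] by the kernel of its
    composite with [p] leaves all higher syzygies unchanged. *)
Lemma resolvable_kernel n M L G (i : {linear M -> L}) (p : {linear L -> G}) :
  ses i p -> GP G -> resolvable GP n L -> resolvable GP n M.
Proof.
case: n => [|n] ip gG /=; first by move=> gL; exact: GP_kernel ip gL gG.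
move=> [K [G0 [u [v [resK gG0 uv]]]]].
have [N [a [b [m [mN ab _]]]]] := ses_kernel uv ip.
by exists K, N, a, b; split=> //; exact: GP_kernel mN gG0 gG.
Qed.

(** As [E] is the sum of [K] and [P], it suffices to add [P] to the first term
    of the resolution of [K]. *)
Lemma resolvable_extension n K E P (i : {linear K -> E}) (p : {linear E -> P}) :
  ses i p -> projective P -> resolvable GP n K -> resolvable GP n E.
Proof.
case: n => [|n] ip projP /=.
  by move=> gK; exact: (GP_extension _ ip gK (projective_GP _ projP)).
have [i_inj exi p_surj] := ip.
move=> [K0 [G0 [u [v [resK gG0 uv]]]]]; have [u_inj exu v_surj] := uv.
have [t tE] := projective_lift idfun projP p_surj.
have [c cE] := exists_copair (i \o v) t.
have [w wE] := exists_pair u (\0 : {linear K0 -> P}).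
have [l lE] := exists_pair (idfun : {linear G0 -> G0}) (\0 : {linear G0 -> P}).
(* [G0 * P] maps onto [E] through a section [t] of [p]. *)
exists K0, (G0 * P)%type, w, c; split=> //.
  apply: (@GP_extension _ _ proj_X G0 _ P l snd) => //; last exact: projective_GP.
  split=> [x y|[x y]|y].
  - by rewrite !lE => -[].
  - by split=> /= [->|[z]]; [exists x; rewrite lE|rewrite lE => -[]].
  - by exists (0, y).
split=> [x y|[x y]|e].
- by rewrite !wE => -[/u_inj].
- split=> [|[z]]; last first.
    by rewrite wE cE => -[<- <-] /=; rewrite (ses_comp0 _ uv) !linear0 addr0.
  rewrite cE /= => e0.
  have y0 : y = 0.
    have := congr1 p e0; rewrite linearD (ses_comp0 _ ip) add0r linear0.
    by rewrite tE.
  move: e0; rewrite y0 linear0 addr0 => /((linear_injP i).1 i_inj)/exu[z uz].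
  by exists z; rewrite wE uz.
- have [k ik] : exists k, i k = e - t (p e).
    by apply/exi; rewrite linearB tE subrr.
  by have [x vx] := v_surj k; exists (x, p e); rewrite cE /= vx ik subrK.
Qed.

(** Dimension shifting: for the syzygy [N] of [G], the induction hypothesis
    Ext^1(N, K) = 0 lifts a map N -> L through P -> L, and Ext^1(G, P) = 0 extends
    the lift to the presentation of [G]. *)
Lemma PD_ext_trivial n L G : PD n L -> GP G -> ext_trivial G L.
Proof.
elim: n L G => [|n IHn] L G /=; first by move=> /proj_X XL /GP_ext_trivial; exact.
move=> [K [P [k [p [pdK projP kp]]]]] gG.
have [_ [N [Q [i [q [gN prQ iq]]]]] _] := GP_coresolving gG.
apply: (ext_trivial_of_presentation prQ iq) => g.
have [E [c [d pb]]] := exists_pullback p g.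
have [a [ad _]] := pullback_ses kp pb.
have [s [r [_ _ ds]]] := ses_split ad (IHn _ _ pdK gN).
have [h hE] := GP_ext_trivial gG (proj_X projP) iq (c \o s).
exists (p \o h) => x; have [com _ _] := pb.
by rewrite /= hE /= com ds.
Qed.

Lemma PD_GP_projective n L : PD n L -> GP L -> projective L.
Proof.
move=> pdL gL; have [_ _ [P [C [i [p [gC prP ip]]]]]] := GP_coresolving gL.
have [r rE] := PD_ext_trivial pdL gC ip idfun.
exact: (projective_retract rE prP).
Qed.

(** The pullback [E] of the projective presentation P -> L with syzygy [K] and
    the Gorenstein projective one G -> L with syzygy [N] is an extension of [P] by
    [N] and of [G] by [K].  So a resolution of [N] gives one of [E], and then one
    of [K], of the same length. *)
Lemma PD_of_resolvable m n L : PD n L -> resolvable GP m L -> PD m L.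
Proof.
elim: m n L => [|m IHm] n L; first exact: PD_GP_projective.
case: n => [|n]; first by move=> projL _; exact: projective_resolvable.
move=> [K [P [k [p [pdK projP kp]]]]] [N [G [j [q [resN gG jq]]]]].
have [E [c [d pb]]] := exists_pullback p q.
have [a [ad _]] := pullback_ses kp pb.
have [b [bc _]] := pullback_ses jq (pullback_sym pb).
have resE := resolvable_extension bc projP resN.
by exists K, P, k, p; split=> //; exact: IHm pdK (resolvable_kernel ad gG resE).
Qed.

(** Inductive step: with K -> L the envelope of the first syzygy [K] of [M], the
    pushout [E] of G <- K -> L is an extension of Gorenstein projective modules.  Embed it in a projective [Q] with Gorenstein projective
    cokernel; then M = E/L embeds in Q/L, whose syzygy [L] has finite projective
    dimension, with cokernel Q/E. *)
Lemma resolvable_envelope n M : resolvable GP n M ->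
  exists L C (i : {linear M -> L}) (p : {linear L -> C}),
    [/\ PD n L, GP C & ses i p].
Proof.
elim: n M => [|n IHn] M /=.
  by move=> /GP_coresolving[_ _ [P [C [i [p [gC prP ip]]]]]]; exists P, C, i, p.
move=> [K [G [u [v [/IHn[L [G' [i [p [pdL gG' ip]]]]] gG uv]]]]].
have [E [a [b po]]] := exists_pushout u i.
have [d [bd _]] := pushout_ses uv po.
have [e [ae _]] := pushout_ses ip (pushout_sym po).
have gE := GP_extension proj_X ae gG gG'.
have [_ _ [Q [C [j [q [gC prQ jq]]]]]] := GP_coresolving gE.
have [N [r [s [t [jbr st _]]]]] := ses_quotient bd jq.
exists N, C, s, t; split=> //.
by exists L, Q, (j \o b), r.
Qed.

Lemma resolution_dim_le (cl1 cl2 : module_class R) M1 M2 :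
    (forall n, has_resolution cl2 M2 n -> has_resolution cl1 M1 n) ->
  (resolution_dim cl1 M1 <= resolution_dim cl2 M2)%E.
Proof.
by move=> sub; apply: ereal_inf_le_tmp => _ [n /sub res_n <-]; exists n.
Qed.

Lemma resolution_dim_finite (cl : module_class R) M :
  (resolution_dim cl M < +oo)%E -> exists n, has_resolution cl M n.
Proof. by move=> /ereal_inf_lt[_ [n res_n _] _]; exists n. Qed.

Lemma X_FGPD_FPD : X_FGPD X = FPD R.
Proof.
have GPiso := @GP_iso X.
have sub P : projective P -> GP P by exact: projective_GP.
apply/eqP; rewrite eq_le; apply/andP; split; apply: ge_ereal_sup => _ [M finM ->].
- have [n /(has_resolution_resolvable GPiso)/resolvable_envelope] :=
    resolution_dim_finite finM.
  move=> [L [C [i [p [pdL gC ip]]]]].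
  have le_dim : (X_Gpd X M <= pd L)%E.
    apply: resolution_dim_le => m /(has_resolution_resolvable projective_iso).
    move=> /(resolvable_sub sub)/(resolvable_kernel ip gC).
    exact: resolvable_has_resolution.
  apply: (le_trans le_dim); apply: ereal_sup_ubound; exists L => //.
  apply: (@le_lt_trans _ _ (n%:R%:E)); last exact: ltry.
  apply: ereal_inf_lbound; exists n => //.
  exact: resolvable_has_resolution.
- have [n /(has_resolution_resolvable projective_iso) pdM] :=
    resolution_dim_finite finM.
  have le_dim : (pd M <= X_Gpd X M)%E.
    apply: resolution_dim_le => m /(has_resolution_resolvable GPiso) resM.
    by apply: resolvable_has_resolution; exact: PD_of_resolvable pdM resM.
  apply: (le_trans le_dim); apply: ereal_sup_ubound; exists M => //.
  apply: (@le_lt_trans _ _ (n%:R%:E)); last exact: ltry.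
  apply: ereal_inf_lbound; exists n => //.
  by apply: resolvable_has_resolution; exact: resolvable_sub sub pdM.
Qed.

End Gorenstein.
End Resolutions.

Theorem theorem3p10 (R : nzRingType) (X : module_class R)
    (hX : forall P : lmodType R, projective P -> X P) :
  FGPD R = X_FGPD X /\ X_FGPD X = FPD R.
Proof.
split; last exact: X_FGPD_FPD.
by rewrite (X_FGPD_FPD hX); exact: (@X_FGPD_FPD R (@projective R)).
Qed.
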